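(* Let $X$ be a Banach space such that $X^*$ is $\mathrm{UMD}^+$. Fix $p\in(1,\infty)$ and $n\in\mathbb N$, and let $q=p/(p-1)$. For every function $F:\{-1,1\}^n\times\{-1,1\}^n\to X$ and $j\in\{1,\ldots,n\}$ denote $$F_j(\varepsilon)=\int_{\{-1,1\}^n}\delta_jF(\varepsilon,\delta)\,d\mu(\delta).$$ Then $$\Bigg(\int_{\{-1,1\}^n}\Big\|\sum_{j=1}^n\Delta^{-1}\partial_jF_j(\varepsilon)\Big\|^pd\mu(\varepsilon)\Bigg)^{1/p}\le\beta_q^+(X^* )\Bigg(\int_{\{-1,1\}^n}\int_{\{-1,1\}^n}\|F(\varepsilon,\delta)\|^pd\mu(\varepsilon)d\mu(\delta)\Bigg)^{1/p}.$$
   Context: $\mu$ is the uniform probability measure on $\{-1,1\}^n$. For a Banach space $X$, $f:\{-1,1\}^n\to X$ and $j\in\{1,\ldots,n\}$, $\partial_jf(\varepsilon)=\frac{f(\varepsilon)-f(\varepsilon_1,\ldots,\varepsilon_{j-1},-\varepsilon_j,\varepsilon_{j+1},\ldots,\varepsilon_n)}{2}$ and $\Delta f=\sum_{j=1}^n\partial_jf$. $\Delta$ is invertible on the space of mean zero functions, and for every $f:\{-1,1\}^n\to X$ one sets $\Delta^{-1}f=\Delta^{-1}\overline f$, where $\overline f=f-\int_{\{-1,1\}^n}f\,d\mu$. (Equivalently, with Walsh functions $W_A(\varepsilon)=\prod_{i\in A}\varepsilon_i$ and $\hat f(A)=\int fW_A\,d\mu$, $\Delta^{-1}f=\sum_{A\ne\emptyset}\frac1{|A|}\hat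 f(A)W_A$.) A Banach space $Z$ is a $\mathrm{UMD}^+$ space if for every $r\in(1,\infty)$ there exists $\beta\in(0,\infty)$ such that if $m\in\mathbb N$ and $\{M_j\}_{j=0}^m$ is an $r$-integrable $Z$-valued martingale defined on some probability space $(\Omega,\mathbb P)$, then $$\int_{\{-1,1\}^m}\int_\Omega\Big\|M_0+\sum_{j=1}^m\varepsilon_j(M_j-M_{j-1})\Big\|^rd\mathbb P\,d\mu(\varepsilon)\le\beta^r\int_\Omega\|M_m\|^rd\mathbb P,$$ where here $\mu$ is the uniform probability measure on $\{-1,1\}^m$. The infimum over those $\beta$ for which this holds (for all such $m$ and martingales) is denoted $\beta_r^+(Z)$. *)

(* Defs.v *)
From HB Require Import structures.
From mathcomp Require Import all_boot all_order all_algebra.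
From mathcomp Require Import all_classical all_reals all_analysis.

Set Implicit Arguments.
Unset Strict Implicit.
Unset Printing Implicit Defensive.

Import Order.TTheory GRing.Theory Num.Theory.
Import numFieldNormedType.Exports.

Local Open Scope classical_set_scope.
Local Open Scope ring_scope.

(* Topological dual of X : continuous linear functionals X -> R with the operator
   norm [dual_norm], as a Banach space. *)
Section Dual.
Context {R : realType} (X : normedModType R).

Definition dual_pred : {pred X -> R^o} :=
  fun f => `[< linear f /\ continuous f >].

Record dual := Dual { dual_fun :> X -> R^o ; _ : dual_fun \in dual_pred }.

HB.instance Definition _ := [isSub for dual_fun].
HB.instance Definition _ := [Choice of dual by <:].

Lemma dualP (f : dual) : linear f /\ continuous f.
Proof. by case: f => f /= /asboolP. Qed.

Fact dual_submod : submod_closed dual_pred.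
Proof.
split.
  apply/asboolP; split; last by move=> x; exact: cvg_cst.
  by move=> a x y /=; rewrite [RHS]addr0 scaler0.
move=> a f g /asboolP[lf cf] /asboolP[lg cg]; apply/asboolP; split.
  move=> b x y.
  rewrite -[LHS]/(a *: f (b *: x + y) + g (b *: x + y)) lf lg.
  rewrite -[RHS]/(b *: (a *: f x + g x) + (a *: f y + g y)).
  by rewrite !scalerDr !scalerA [a * b]mulrC addrACA.
by move=> x; apply: cvgD; [apply: cvgZr; exact: cf|exact: cg].
Qed.
HB.instance Definition _ := GRing.isSubmodClosed.Build R (X -> R^o) dual_pred
  dual_submod.
HB.instance Definition _ := [SubChoice_isSubLmodule of dual by <:].

Definition dual_norm (f : dual) : R := sup [set `|f x| | x in [set x | `|x| <= 1]].

Lemma dual_linfun (f : dual) : {g : {linear X -> R^o} | g = f :> (X -> R^o)}.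
Proof.
have [lf _] := dualP f.
pose m := GRing.isLinear.Build R X R^o *:%R (f : X -> R^o) lf.
pose g : {linear X -> R^o} := HB.pack (f : X -> R^o) m.
by exists g.
Qed.

Lemma dual_bounded (f : dual) : exists2 M, 0 <= M & forall x, `|f x| <= M * `|x|.
Proof.
have [g gE] := dual_linfun f; have [_ cf] := dualP f.
have cg : continuous g by rewrite gE.
have /linear_boundedP/pinfty_ex_gt0[M M0 HM] := continuous_linear_bounded 0 (cg 0).
by exists M; [exact: ltW|move=> x; rewrite -gE].
Qed.

Lemma dual0x (x : X) : (0 : dual) x = 0. Proof. by []. Qed.
Lemma dualDx (f g : dual) (x : X) : (f + g) x = f x + g x. Proof. by []. Qed.
Lemma dualNx (f : dual) (x : X) : (- f) x = - f x. Proof. by []. Qed.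
Lemma dualZx (a : R) (f : dual) (x : X) : (a *: f) x = a * f x. Proof. by []. Qed.

Lemma dual_fun0 (f : dual) : f 0 = 0.
Proof. by have [g <-] := dual_linfun f; rewrite linear0. Qed.

Lemma dual_funZ (f : dual) a x : f (a *: x) = a * f x.
Proof. by have [g <-] := dual_linfun f; rewrite linearZ. Qed.

Lemma dual_norm_has_sup (f : dual) :
  has_sup [set `|f x| | x in [set x | `|x| <= 1]].
Proof.
split; first by exists `|f 0|, 0 => //=; rewrite normr0.
have [M M0 HM] := dual_bounded f; exists M => _ [x /= x1 <-].
by rewrite (le_trans (HM x))// ler_piMr.
Qed.

Lemma dual_norm_ub (f : dual) x : `|x| <= 1 -> `|f x| <= dual_norm f.
Proof.
by move=> x1; apply: (sup_upper_bound (dual_norm_has_sup f)); exists x.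
Qed.

Lemma dual_norm_le (f : dual) M :
  (forall x, `|x| <= 1 -> `|f x| <= M) -> dual_norm f <= M.
Proof.
move=> H; apply: ge_sup; first by case: (dual_norm_has_sup f).
by move=> _ [x /= x1 <-]; exact: H.
Qed.

Lemma dual_normP (f : dual) x : `|f x| <= dual_norm f * `|x|.
Proof.
have [->|x0] := eqVneq x 0; first by rewrite dual_fun0 !normr0 mulr0.
have nx : 0 < `|x| by rewrite normr_gt0.
rewrite -ler_pdivrMr// mulrC -[X in X * _]ger0_norm ?invr_ge0//.
rewrite -normrM -dual_funZ; apply: dual_norm_ub.
by rewrite normrZ ger0_norm ?invr_ge0// mulVf ?normr_eq0.
Qed.

Lemma dual_norm_ge0 (f : dual) : 0 <= dual_norm f.
Proof.
by rewrite (le_trans _ (@dual_norm_ub f 0 _)) ?normr0.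
Qed.

Fact dual_ler_normD f g : dual_norm (f + g) <= dual_norm f + dual_norm g.
Proof.
apply: dual_norm_le => x x1; rewrite dualDx (le_trans (ler_normD _ _))//.
by rewrite lerD// dual_norm_ub.
Qed.

Fact dual_normrZ a f : dual_norm (a *: f) = `|a| * dual_norm f.
Proof.
have key b g : dual_norm (b *: g) <= `|b| * dual_norm g.
  apply: dual_norm_le => x x1.
  by rewrite dualZx normrM ler_wpM2l// dual_norm_ub.
apply/eqP; rewrite eq_le key/=.
have [->|a0] := eqVneq a 0; first by rewrite normr0 mul0r dual_norm_ge0.
have := key a^-1 (a *: f); rewrite scalerA mulVf// scale1r normfV.
by rewrite mulrC ler_pdivlMr ?normr_gt0// mulrC.
Qed.

Fact dual_normr0_eq0 f : dual_norm f = 0 -> f = 0.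
Proof.
move=> f0; apply/val_inj/funext => x /=.
by apply/normr0_eq0/le_anti; rewrite normr_ge0 -(mul0r `|x|) -f0 dual_normP.
Qed.

HB.instance Definition _ := Lmodule_isNormed.Build R dual
  dual_ler_normD dual_normrZ dual_normr0_eq0.

Lemma dual_normE (f : dual) : `|f| = dual_norm f. Proof. by []. Qed.

Fact dual_complete (F : set_system dual) : ProperFilter F -> cauchy F -> cvg F.
Proof.
move=> FF /cauchyP cF.
have cFx x : cvg ((fun f : dual => f x : R^o) @ F).
  apply/cauchy_cvgP/cauchyP => e e0.
  have x1 : 0 < e / (`|x| + 1) by rewrite divr_gt0// ltr_wpDl.
  have [g Hg] := cF _ x1; exists (g x).
  suff : F [set f : dual | ball (g x : R^o) e (f x)] by [].
  apply: filterS Hg => f; rewrite -!ball_normE /ball_/= => fg.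
  suff : `|(g - f) x| < e by [].
  apply: (le_lt_trans (dual_normP _ _)); rewrite -dual_normE.
  apply: (@le_lt_trans _ _ (`|g - f| * (`|x| + 1))).
    by rewrite ler_wpM2l// lerDl.
  by rewrite -ltr_pdivlMr// ltr_wpDl.
pose l (x : X) : R^o := lim ((fun f : dual => f x) @ F).
have lP x : (fun f : dual => f x) @ F --> l x by exact: cFx.
have ll : linear l.
  move=> a x y.
  have H : (fun f : dual => f (a *: x + y)) @ F --> a *: l x + l y.
    rewrite (_ : (fun f : dual => _) = fun f : dual => a *: (f x : R^o) + f y).
      by apply: cvgD; [apply: cvgZr; exact: lP|exact: lP].
    by apply/funext => f; have [-> _] := dualP f.
  by rewrite -(cvg_lim _ H).
have lclose (e : R) : 0 < e ->
    F [set f : dual | forall x, `|l x - f x| <= e * `|x|].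
  move=> e0; have e2 : 0 < e / 2 by rewrite divr_gt0.
  have [g Hg] := cF _ e2.
  have gf f x : ball g (e / 2) f -> `|f x - g x| <= e / 2 * `|x|.
    rewrite -ball_normE/= => /ltW gf; suff : `|(f - g) x| <= e / 2 * `|x| by [].
    by rewrite (le_trans (dual_normP _ _))// ler_wpM2r// -dual_normE distrC.
  have lg x : `|l x - g x| <= e / 2 * `|x|.
    have H : (fun f : dual => `|f x - g x|) @ F --> `|l x - g x|.
      by apply: cvg_norm; apply: cvgB; [exact: lP|exact: cvg_cst].
    rewrite -(cvg_lim _ H)//; apply: limr_le; first by apply/cvg_ex; eexists; exact: H.
    by apply: filterS Hg => f; exact: gf.
  apply: filterS Hg => f Hf x.
  rewrite [e]splitr mulrDl -[l x](subrK (g x)) -addrA (le_trans (ler_normD _ _))//.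
  by rewrite lerD// distrC gf.
have lc : continuous l.
  pose m := GRing.isLinear.Build R X R^o *:%R l ll.
  pose L : {linear X -> R^o} := HB.pack l m.
  apply: (@bounded_linear_continuous R X R^o L).
  apply/linear_boundedP.
  have [f Hf] := filter_ex (lclose 1 ltr01).
  exists (1 + dual_norm f); split; first exact: num_real.
  move=> r rM x /=.
  rewrite -(subrK (f x) (l x)) (le_trans (ler_normD _ _))//.
  rewrite (le_trans (lerD (Hf x) (dual_normP f x)))// -mulrDl.
  by rewrite ler_wpM2r// ltW.
have lD : l \in dual_pred by apply/asboolP.
apply/cvg_ex; exists (Dual lD).
apply/cvgrPdist_le => e e0.
near=> f; rewrite dual_normE; apply: dual_norm_le => x x1.
suff : `|l x - f x| <= e by [].
have Hf : forall x, `|l x - f x| <= e * `|x| by near: f; exact: lclose.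
by rewrite (le_trans (Hf x))// ler_piMr// ltW.
Unshelve. all: by end_near. Qed.

HB.instance Definition _ := Uniform_isComplete.Build dual dual_complete.

End Dual.

(* The discrete cube {-1,1}^n, encoded as bit vectors: the bit b stands for the
   sign (-1) ^+ b, see [sgn]. *)
Definition cube (n : nat) : finType := {ffun 'I_n -> bool}.

Section Cube.
Context {R : realType} (n : nat).

Definition sgn (e : cube n) (j : 'I_n) : R := (-1) ^+ e j.

Definition flip (j : 'I_n) (e : cube n) : cube n :=
  [ffun i => if i == j then ~~ e i else e i].

Section Lmodule.
Context {V : lmodType R}.
Implicit Types f g : cube n -> V.

(* Integral against the uniform probability measure on the cube. *)
Definition cube_mean f : V := (2 ^+ n)^-1 *: \sum_(e : cube n) f e.

Definition partial (j : 'I_n) f : cube n -> V :=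
  fun e => 2^-1 *: (f e - f (flip j e)).

Definition laplacian f : cube n -> V := fun e => \sum_(j < n) partial j f e.

(* The inverse of the Laplacian on mean zero functions, precomposed with
   centering; [inv_laplacianP] and [inv_laplacian_unique] below show that the
   condition determines the function, so that the default value is not used. *)
Definition inv_laplacian f : cube n -> V :=
  xget (fun=> 0) [set g | cube_mean g = 0 /\
                          laplacian g = (fun e => f e - cube_mean f)].

Definition walsh (A : {set 'I_n}) (e : cube n) : R := \prod_(i in A) sgn e i.

Definition walsh_coef f (A : {set 'I_n}) : V :=
  cube_mean (fun e => walsh A e *: f e).

End Lmodule.

Lemma flipK j : involutive (flip j).
Proof.
by move=> e; apply/ffunP => i; rewrite !ffunE; case: eqP => // _; rewrite negbK.
Qed.

Lemma sgn_flip j e i : sgn (flip j e) i = if i == j then - sgn e i else sgn e i.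
Proof. by rewrite /sgn ffunE; case: eqP => // _; rewrite signrN. Qed.

Lemma walsh_flip j A e :
  walsh A (flip j e) = if j \in A then - walsh A e else walsh A e.
Proof.
rewrite /walsh; under eq_bigr => i _ do rewrite sgn_flip.
case: ifPn => jA.
  rewrite (bigD1 j)//= eqxx mulNr [in RHS](bigD1 j)//=; congr (- (_ * _)).
  by apply: eq_bigr => i /andP[_ /negPf ->].
apply: eq_bigr => i iA; case: eqP => // ij; by rewrite -ij iA in jA.
Qed.

Lemma reindex_flip (V : lmodType R) j (f : cube n -> V) :
  \sum_e f e = \sum_e f (flip j e).
Proof. by rewrite (reindex_inj (can_inj (flipK j))). Qed.

Lemma cube_mean_flip (V : lmodType R) j (f : cube n -> V) :
  cube_mean f = cube_mean (fun e => f (flip j e)).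
Proof. by rewrite /cube_mean (reindex_flip j). Qed.

Lemma sum_walsh (e d : cube n) :
  \sum_(A : {set 'I_n}) walsh A e * walsh A d = if e == d then 2 ^+ n else 0.
Proof.
transitivity (\prod_(i < n) (sgn e i * sgn d i + 1)).
  rewrite bigA_distr; apply: eq_big => [A|A _]; first by rewrite inE.
  by rewrite /walsh -big_split/= big_mkcond.
case: eqP => [->|/eqP ed].
  rewrite (eq_bigr (fun=> 2)) ?prodr_const ?card_ord// => i _.
  by rewrite /sgn -expr2 sqrr_sign.
have /existsP[i ei] : [exists i, e i != d i].
  rewrite -negb_forall; apply: contra ed => /forallP H.
  by apply/eqP/ffunP => i; apply/eqP.
rewrite (bigD1 i)//= /sgn.
by case: (e i) (d i) ei => -[]//= _; rewrite expr0 expr1 ?mulr1 ?mul1r addNr mul0r.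
Qed.

Context {V : lmodType R}.
Implicit Types f g : cube n -> V.

Let pow2_neq0 : (2 ^+ n : R) != 0.
Proof. by rewrite expf_neq0. Qed.

Let scaleC (a b : R) (v : V) : a *: (b *: v) = b *: (a *: v).
Proof. by rewrite !scalerA mulrC. Qed.

Lemma walsh_expansion f e : f e = \sum_A walsh A e *: walsh_coef f A.
Proof.
rewrite /walsh_coef /cube_mean.
under eq_bigr => A _ do rewrite scalerA mulrC -scalerA scaler_sumr.
rewrite -scaler_sumr exchange_big/=.
under eq_bigr => d _.
  under eq_bigr => A _ do rewrite scalerA.
  rewrite -scaler_suml sum_walsh; over.
rewrite (bigD1 e)//= eqxx big1 ?addr0 ?scalerA ?mulVf ?scale1r// => d.
by rewrite eq_sym => /negPf ->; rewrite scale0r.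
Qed.

Lemma laplacian_walsh A (v : V) e :
  laplacian (fun e => walsh A e *: v) e = #|A|%:R *: (walsh A e *: v).
Proof.
rewrite /laplacian -sum1_card natr_sum scaler_suml [RHS]big_mkcond/=.
apply: eq_bigr => j _; rewrite /partial walsh_flip -scalerBl.
case: ifPn => _; last by rewrite subrr scale0r scaler0.
rewrite opprK -mulr2n -(mulr_natl (walsh A e)) !scalerA mul1r.
by rewrite mulrA mulVf ?mul1r// pnatr_eq0.
Qed.

Lemma laplacian_sum (I : finType) (P : pred I) (F : I -> cube n -> V) :
  laplacian (fun e => \sum_(i | P i) F i e) =
  fun e => \sum_(i | P i) laplacian (F i) e.
Proof.
apply/funext => e; rewrite /laplacian exchange_big/=; apply: eq_bigr => j _.
by rewrite /partial -sumrB scaler_sumr.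
Qed.

Lemma walsh_coef_laplacian f A :
  walsh_coef (laplacian f) A = #|A|%:R *: walsh_coef f A.
Proof.
rewrite -sum1_card natr_sum scaler_suml [RHS]big_mkcond/= /walsh_coef.
transitivity (\sum_(j < n) cube_mean (fun e => walsh A e *: partial j f e)).
  rewrite /cube_mean -scaler_sumr exchange_big/=; congr (_ *: _).
  by apply: eq_bigr => e _; rewrite -scaler_sumr.
apply: eq_bigr => j _.
have -> : cube_mean (fun e => walsh A e *: partial j f e) =
    2^-1 *: (cube_mean (fun e => walsh A e *: f e) -
             cube_mean (fun e => walsh A (flip j e) *: f e)).
  rewrite [X in _ - X](cube_mean_flip j) /cube_mean -scalerBr -sumrB.
  rewrite [RHS]scaleC; congr (_ *: _); rewrite scaler_sumr.
  by apply: eq_bigr => e _; rewrite flipK /partial -scalerBr scaleC.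
under [X in _ - cube_mean X]eq_fun => e do rewrite walsh_flip.
case: ifPn => _; last by rewrite subrr scaler0.
have -> : cube_mean (fun e => - walsh A e *: f e) =
    - cube_mean (fun e => walsh A e *: f e).
  rewrite /cube_mean -scalerN -sumrN; congr (_ *: _).
  by apply: eq_bigr => e _; rewrite scaleNr.
rewrite opprK -mulr2n -(scaler_nat _ (cube_mean _)) scalerA.
by rewrite mulVf// pnatr_eq0.
Qed.

Lemma walsh_coef0 f : walsh_coef f finset.set0 = cube_mean f.
Proof.
rewrite /walsh_coef; congr cube_mean; apply/funext => e.
by rewrite /walsh big_set0 scale1r.
Qed.

Lemma laplacian_inj f g : cube_mean f = cube_mean g ->
  laplacian f = laplacian g -> f = g.
Proof.
move=> mfg Lfg; apply/funext => e; rewrite [LHS]walsh_expansion walsh_expansion.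
apply: eq_bigr => A _; congr (_ *: _).
have [->|A0] := eqVneq A finset.set0; first by rewrite !walsh_coef0.
have cA0 : #|A|%:R != 0 :> R by rewrite pnatr_eq0 cards_eq0.
by apply: (scalerI cA0); rewrite -!walsh_coef_laplacian Lfg.
Qed.

Lemma cube_mean_walsh A (v : V) : A != finset.set0 ->
  cube_mean (fun e => walsh A e *: v) = 0.
Proof.
move=> /finset.set0Pn[j jA]; rewrite /cube_mean -scaler_suml.
suff -> : \sum_(e : cube n) walsh A e = 0 by rewrite scale0r scaler0.
have /eqP : \sum_(e : cube n) walsh A e = - \sum_(e : cube n) walsh A e.
  rewrite [LHS](reindex_inj (can_inj (flipK j)))/= -sumrN.
  by apply: eq_bigr => e _; rewrite walsh_flip jA.
by rewrite -addr_eq0 -mulr2n mulrn_eq0/= => /eqP.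
Qed.

Let inv_laplacian_walsh f : cube n -> V :=
  fun e => \sum_(A | A != finset.set0) #|A|%:R^-1 *: (walsh A e *: walsh_coef f A).

Let inv_laplacian_walshP f : cube_mean (inv_laplacian_walsh f) = 0 /\
  laplacian (inv_laplacian_walsh f) = (fun e => f e - cube_mean f).
Proof.
split.
  rewrite /cube_mean /inv_laplacian_walsh exchange_big/= scaler_sumr.
  rewrite big1// => A A0; rewrite -scaler_sumr scalerA mulrC -scalerA.
  by rewrite -/(cube_mean _) cube_mean_walsh// scaler0.
rewrite /inv_laplacian_walsh laplacian_sum; apply/funext => e.
rewrite [f e]walsh_expansion [in RHS](bigD1 finset.set0)//= walsh_coef0.
rewrite [X in X *: _ + _](_ : _ = 1) ?scale1r; last by rewrite /walsh big_set0.
rewrite addrAC subrr add0r; apply: eq_bigr => A A0.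
have cA0 : #|A|%:R != 0 :> R by rewrite pnatr_eq0 cards_eq0.
rewrite (_ : (fun _ => _) = fun e => walsh A e *: (#|A|%:R^-1 *: walsh_coef f A)).
  by rewrite laplacian_walsh [X in _ *: X]scaleC scalerA mulfV ?scale1r.
by apply/funext => d; rewrite scaleC.
Qed.

Lemma inv_laplacianP f : cube_mean (inv_laplacian f) = 0 /\
  laplacian (inv_laplacian f) = (fun e => f e - cube_mean f).
Proof.
rewrite /inv_laplacian; case: xgetP => [g _ //|/(_ (inv_laplacian_walsh f))[]].
exact: inv_laplacian_walshP.
Qed.

Lemma inv_laplacian_unique f g : cube_mean g = 0 ->
  laplacian g = (fun e => f e - cube_mean f) -> g = inv_laplacian f.
Proof.
move=> g0 Lg; have [h0 Lh] := inv_laplacianP f.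
by apply: laplacian_inj; rewrite ?g0 ?h0 ?Lg ?Lh.
Qed.

Lemma inv_laplacian_walshE f : inv_laplacian f =
  fun e => \sum_(A | A != finset.set0) #|A|%:R^-1 *: (walsh A e *: walsh_coef f A).
Proof.
by have [h0 Lh] := inv_laplacian_walshP f; rewrite -(inv_laplacian_unique h0 Lh).
Qed.

End Cube.

Section Bochner.
Context {R : realType} {d : measure_display} {T : measurableType d}
  {Z : normedModType R}.
Implicit Types (G : set (set T)) (P : {measure set T -> \bar R})
  (A : set T) (f s : T -> Z).

Definition simple_fun G s : Prop :=
  finite_set (range s) /\ forall z, G (s @^-1` [set z]).

Definition simple_integral P A s : Z :=
  \sum_(z \in range s) fine (P (A `&` s @^-1` [set z])) *: z.

Definition strongly_measurable G f : Prop :=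
  exists s : nat -> T -> Z, (forall k, simple_fun G (s k)) /\
    forall t, (fun k => s k t) @ \oo --> f t.

(* The Bochner integral as a relation: f is Bochner integrable on A, with
   integral v. *)
Definition has_bochner_integral P A f (v : Z) : Prop :=
  strongly_measurable measurable f /\
  exists s : nat -> T -> Z,
    [/\ forall k, simple_fun measurable (s k),
        (fun k => \int[P]_(t in A) `|f t - s k t|%:E)%E @ \oo --> 0%E
      & (fun k => simple_integral P A (s k)) @ \oo --> v].

(* g is a version of E(f | G) *)
Definition is_cond_expectation P G f g : Prop :=
  strongly_measurable G g /\
  forall A, G A -> exists v,
    has_bochner_integral P A f v /\ has_bochner_integral P A g v.

Definition filtration (m : nat) (F : nat -> set (set T)) : Prop :=
  (forall j, (j <= m)%N -> sigma_algebra setT (F j) /\ F j `<=` measurable) /\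
  (forall i j, (i <= j <= m)%N -> F i `<=` F j).

(* M_0, ..., M_m is an r-integrable martingale with respect to F_0, ..., F_m;
   the values of F and M at indices above m are irrelevant. *)
Definition Lr_martingale P (r : R) (m : nat) (F : nat -> set (set T))
    (M : nat -> T -> Z) : Prop :=
  [/\ filtration m F,
      forall j, (j <= m)%N -> strongly_measurable (F j) (M j),
      forall j, (j <= m)%N -> (\int[P]_t (`|M j t| `^ r)%:E < +oo)%E
    & forall i j, (i <= j <= m)%N -> is_cond_expectation P (F i) (M j) (M i)].

End Bochner.

Section UMD.
Context {R : realType} (Z : completeNormedModType R).

Definition UMDplus_bound (r beta : R) : Prop :=
  forall (m : nat) (d : measure_display) (T : measurableType d)
    (P : probability T R) (F : nat -> set (set T)) (M : nat -> T -> Z),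
  Lr_martingale P r m F M ->
  (((2 ^+ m)^-1)%:E * \sum_(e : cube m)
     \int[P]_t
       (`|M 0%N t + \sum_(j < m) sgn e j *: (M j.+1 t - M j t)| `^ r)%:E
   <= (beta `^ r)%:E * \int[P]_t (`|M m t| `^ r)%:E)%E.

Definition UMDplus : Prop :=
  forall r : R, 1 < r -> exists2 beta, 0 < beta & UMDplus_bound r beta.

Definition UMDplus_const (r : R) : R :=
  inf [set beta | 0 < beta /\ UMDplus_bound r beta].

End UMD.

Definition rademacher_coef {R : realType} {V : lmodType R} (n : nat)
    (F : cube n -> cube n -> V) (j : 'I_n) : cube n -> V :=
  fun e => cube_mean (fun d => sgn d j *: F e d).

(* Main.v *)
Require Import Defs.
From HB Require Import structures.
From mathcomp Require Import all_boot all_order all_algebra.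
From mathcomp Require Import all_classical all_reals all_analysis.
From mathcomp Require Import perm ring lra.

(* By duality it is enough to bound E_{eps,del} <S G(eps, del), F(eps, del)> for
   G : {-1,1}^n -> X^*, where S G(eps, del) = sum_j del_j Delta^{-1} d_j G(eps).
   Revealing the coordinates of eps in the order given by a permutation turns G
   into a martingale whose increment at j keeps the Walsh terms W_A in which j is
   the last element of A.  For a uniformly random permutation every element of A
   is last with probability 1/|A|, so these increments average to
   Delta^{-1} d_j G.  Hence S G is an average of randomly signed martingale
   increments, each controlled by the UMD^+ inequality of X^* and Hoelder's
   inequality; choosing G(eps) to norm the left-hand side concludes. *)

Set Implicit Arguments.
Unset Strict Implicit.
Unset Printing Implicit Defensive.

Import Order.TTheory GRing.Theory Num.Theory.
Import numFieldNormedType.Exports.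

Local Open Scope classical_set_scope.
Local Open Scope ring_scope.

(** * Hahn-Banach through minimal sublinear functions *)

Section Sublinear.
Context {R : realType} {V : lmodType R}.
Implicit Types (f g : V -> R) (x y : V).

Definition sublinear f : Prop :=
  [/\ forall x y, f (x + y) <= f x + f y, f 0 = 0 &
      forall a x, 0 < a -> f (a *: x) <= a * f x].

Lemma sublinearZ f a x : sublinear f -> 0 <= a -> f (a *: x) = a * f x.
Proof.
move=> [_ f0 fZ]; rewrite le_eqVlt => /predU1P[<-|a0].
  by rewrite scale0r f0 mul0r.
apply/le_anti; rewrite fZ//= mulrC -ler_pdivlMr// mulrC.
have {1}-> : x = a^-1 *: (a *: x) by rewrite scalerA mulVf ?gt_eqF// scale1r.
by rewrite fZ// invr_gt0.
Qed.

Lemma sublinear_geN f x : sublinear f -> - f (- x) <= f x.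
Proof. by move=> [fD f0 _]; rewrite lerNl -subr_ge0 opprK addrC -f0 -(subrr x). Qed.

(** Supplies the bounds of chains for Zorn's lemma. The common majorant [h] keeps the infimum
    finite, since [f x >= - f (- x) >= - h (- x)]. *)
Lemma inf_sublinear (A : set (V -> R)) (h : V -> R) :
  A !=set0 -> total_on A (fun f g => forall x, g x <= f x) ->
  (forall f, A f -> sublinear f /\ forall x, f x <= h x) ->
  sublinear (fun x => inf [set f x | f in A]).
Proof.
move=> [f1 Af1] tA sA.
have lb f x : A f -> inf [set f x | f in A] <= f x.
  move=> Af; apply: ge_inf; last by exists f.
  exists (- h (- x)) => _ [g Ag <-]; have [sg gh] := sA _ Ag.
  by apply: le_trans (sublinear_geN x sg); rewrite lerN2.
have glb c x : (forall f, A f -> c <= f x) -> c <= inf [set f x | f in A].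
  by move=> H; apply: lb_le_inf; [exists (f1 x), f1|move=> _ [g Ag <-]; exact: H].
split.
- move=> x y /=; rewrite -lerBlDr; apply: (glb) => f Af.
  rewrite lerBlDr [f x + _]addrC -lerBlDr; apply: (glb) => g Ag; rewrite lerBlDr.
  (* Two members of a chain are comparable, so the smaller one, here [f], can serve at both [x] and
     [y]. *)
  wlog fg : x y f g Af Ag / forall z, f z <= g z.
    move=> W; have [fg|gf] := tA _ _ Af Ag; last exact: W.
    by rewrite (addrC x) (addrC (g y)); exact: W.
  have [[fD _ _] _] := sA _ Af.
  apply: (le_trans (lb f _ Af)); apply: (le_trans (fD _ _)).
  by rewrite addrC lerD.
- apply/le_anti/andP; split.
    by have [[_ f0 _] _] := sA _ Af1; rewrite -f0; exact: lb.
  by apply: (glb) => f Af; have [[_ -> _] _] := sA _ Af.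
- move=> a x a0 /=; rewrite mulrC -ler_pdivrMr//; apply: (glb) => f Af.
  have [[_ _ fZ] _] := sA _ Af.
  by rewrite ler_pdivrMr// mulrC (le_trans (lb f _ Af))// fZ.
Qed.

(** For sublinear [f] this is a sublinear minorant of [f] whose value at [- y] is at most [- f y]
    (take [t = 1]), which makes it linear along [y]. *)
Definition slope_inf f y x : R :=
  inf [set f (x + t *: y) - t * f y | t in [set t | 0 <= t]].

Lemma slope_inf_le f y x t : sublinear f -> 0 <= t ->
  slope_inf f y x <= f (x + t *: y) - t * f y.
Proof.
move=> sf t0; apply: ge_inf; last by exists t.
(* Subadditivity at [s *: y = (x + s *: y) - x] gives a lower bound independent of [s]. *)
exists (- f (- x)) => _ [s s0 <-]; have [fD _ _] := sf.
rewrite lerBrDr addrC lerBlDr -sublinearZ// addrC.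
by rewrite (le_trans _ (fD _ _))// addrA addNr add0r.
Qed.

Lemma slope_inf_ge f y x c :
  (forall t, 0 <= t -> c <= f (x + t *: y) - t * f y) -> c <= slope_inf f y x.
Proof.
move=> H; apply: lb_le_inf; first by exists (f (x + 0 *: y) - 0 * f y), 0 => /=.
by move=> _ [t t0 <-]; exact: H.
Qed.

Lemma slope_inf_le_id f y x : sublinear f -> slope_inf f y x <= f x.
Proof.
move=> sf; have := slope_inf_le y x sf (lexx 0).
by rewrite scale0r addr0 mul0r subr0.
Qed.

(** Parameters [t] at [x] and [s] at [z] combine into [s + t] at [x + z]; scaling by [a] turns [t]
    into [a * t]. *)
Lemma slope_inf_sublinear f y : sublinear f -> sublinear (slope_inf f y).
Proof.
move=> sf; have [fD f0 fZ] := sf; split.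
- move=> x z; rewrite -lerBlDr; apply: slope_inf_ge => t t0.
  rewrite lerBlDr [_ - _ + _]addrC -lerBlDr.
  apply: slope_inf_ge => s s0; rewrite lerBlDr.
  apply: (le_trans (slope_inf_le _ _ sf (addr_ge0 s0 t0))).
  have -> : x + z + (s + t) *: y = (z + s *: y) + (x + t *: y).
    by rewrite scalerDl (addrC x) addrACA.
  by have H := fD (z + s *: y) (x + t *: y); lra.
- apply/le_anti; rewrite -{1}f0 slope_inf_le_id//=.
  by apply: slope_inf_ge => t t0; rewrite add0r sublinearZ// subrr.
- move=> a x a0; rewrite mulrC -ler_pdivrMr//; apply: slope_inf_ge => t t0.
  rewrite ler_pdivrMr// [_ * a]mulrC.
  apply: (le_trans (slope_inf_le _ _ sf (mulr_ge0 (ltW a0) t0))).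
  by rewrite -scalerA -scalerDr sublinearZ ?(ltW a0)// mulrBr mulrA.
Qed.

(* A minimal sublinear minorant g is additive: it equals slope_inf g y, and t = 1
   in that infimum gives g x <= g (x + y) - g y. *)
Lemma sublinear_minorant_linear f : sublinear f ->
  exists g : V -> R, (forall a x y, g (a *: x + y) = a * g x + g y) /\
    forall x, g x <= f x.
Proof.
move=> sf; pose Q g := sublinear g /\ forall x, g x <= f x; pose T := sig Q.
(* [P] reverses the pointwise order, so a maximal element for it is a minimal minorant. *)
pose P (s t : T) := `[< forall x, sval t x <= sval s x >].
have [|||A tA|[g [sg gf]] gmin] := @Zorn T P.
- by move=> t; apply/asboolP.
- move=> r s t /asboolP rs /asboolP st; apply/asboolP => x.
  exact: le_trans (st x) (rs x).
- move=> [s Hs] [t Ht] /asboolP/= st /asboolP/= ts.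
  by apply: eq_exist; apply/funext => x; apply/le_anti; rewrite st ts.
- have [[t0 At0]|A0] := pselect (A !=set0); last first.
    (* The empty chain is bounded by [f] itself. *)
    exists (exist Q f (conj sf (fun x => lexx _))) => s As.
    by exfalso; apply: A0; exists s.
  have B f1 : [set sval t | t in A] f1 -> sublinear f1 /\ forall x, f1 x <= f x.
    by move=> [t _ <-]; exact: svalP t.
  have sB : sublinear (fun x => inf [set f1 x | f1 in [set sval t | t in A]]).
    apply: (inf_sublinear _ _ B); first by exists (sval t0), t0.
    by move=> _ _ [s As <-] [t At <-]; have [/asboolP|/asboolP] := tA _ _ As At;
      [left|right].
  have leB x t : A t ->
      inf [set f1 x | f1 in [set sval t | t in A]] <= sval t x.
    move=> At; apply: ge_inf; last by exists (sval t) => //; exists t.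
    exists (- f (- x)) => _ [g Bg <-]; have [sg gf] := B _ Bg.
    by apply: le_trans (sublinear_geN x sg); rewrite lerN2.
  have Bf x : inf [set f1 x | f1 in [set sval t | t in A]] <= f x.
    exact: le_trans (leB x _ At0) ((svalP t0).2 x).
  by exists (exist Q _ (conj sB Bf)) => s As; apply/asboolP => x; exact: leB.
have gD x y : g (x + y) = g x + g y.
  apply/le_anti; have [-> _ _] := sg => /=.
  have le1 z : slope_inf g y z <= f z.
    exact: le_trans (slope_inf_le_id y z sg) (gf z).
  have := gmin (exist Q _ (conj (slope_inf_sublinear y sg) le1)).
  have /[swap]/[apply] : P (exist Q _ (conj sg gf))
      (exist Q _ (conj (slope_inf_sublinear y sg) le1)).
    by apply/asboolP => z; exact: slope_inf_le_id.
  move=> /(congr1 sval)/= gE; rewrite -lerBrDr -{1}gE.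
  by have := slope_inf_le y x sg ler01; rewrite scale1r mul1r.
have [_ g0 _] := sg.
have gN x : g (- x) = - g x.
  by apply/eqP; rewrite -addr_eq0 -gD addNr g0.
exists g; split=> // a x y; rewrite gD; congr (_ + _).
have [a0|a0] := leP 0 a; first exact: sublinearZ.
rewrite -[a]opprK scaleNr gN sublinearZ// ?mulNr// oppr_ge0 ltW//.
Qed.

End Sublinear.

Lemma norming_functional (R : realType) (X : normedModType R) (x : X) :
  exists f : dual X, `|f| <= 1 /\ f x = `|x|.
Proof.
have sn : sublinear (fun y : X => `|y|).
  split; [exact: ler_normD|exact: normr0|].
  by move=> a y a0; rewrite normrZ gtr0_norm.
(* slope_inf is at most - `|x| at - x, which forces equality at x. *)
have [g [gl gle]] := sublinear_minorant_linear (slope_inf_sublinear x sn).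
have g0 : g 0 = 0.
  by have := gl 1 0 0; rewrite scale1r addr0 mul1r => H; lra.
have gN y : g (- y) = - g y.
  by rewrite -[- y]addr0 -scaleN1r gl g0 addr0 mulN1r.
have gnorm y : g y <= `|y| by rewrite (le_trans (gle y))// slope_inf_le_id.
have gabs y : `|g y| <= `|y|.
  by rewrite ler_norml gnorm andbT lerNl -gN -normrN gnorm.
pose G : {linear X -> R^o} :=
  HB.pack (g : X -> R^o) (GRing.isLinear.Build R X R^o *:%R (g : X -> R^o) gl).
have cG : continuous G.
  apply: bounded_linear_continuous; apply/linear_boundedP.
  exists 1; split; first exact: num_real.
  by move=> r /ltW r1 y /=; rewrite (le_trans (gabs y))// ler_peMl.
have dG : (g : X -> R^o) \in dual_pred (X:=X) by apply/asboolP; split; [exact: gl|exact: cG].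
exists (Dual dG); split.
  by rewrite dual_normE; apply: dual_norm_le => y; apply: le_trans (gabs y).
apply/le_anti; rewrite gnorm/= -[g x]opprK -gN lerNr.
apply: (le_trans (gle _)); apply: (le_trans (slope_inf_le _ _ sn ler01)).
by rewrite scale1r addNr normr0 mul1r sub0r.
Qed.

(** * Hölder's inequality for finite weighted sums *)

Lemma weighted_hoelder (R : realType) (I : finType) (w p q : R) (a b : I -> R) :
  0 < w -> 0 < p -> 0 < q -> p^-1 + q^-1 = 1 ->
  (forall i, 0 <= a i) -> (forall i, 0 <= b i) ->
  w * \sum_i a i * b i <=
    (w * \sum_i a i `^ p) `^ p^-1 * (w * \sum_i b i `^ q) `^ q^-1.
Proof.
move=> w0 p0 q0 pq a0 b0.
have nz (c : I -> R) r : 0 < r -> (forall i, 0 <= c i) ->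
    w * \sum_i c i `^ r = 0 -> forall i, c i = 0.
  move=> r0 c0 /eqP; rewrite mulf_eq0 gt_eqF//= psumr_eq0; last first.
    by move=> i _; exact: powR_ge0.
  by move=> /allP c0' i; apply: (@powR_eq0_eq0 _ _ r); apply/eqP/(implyP (c0' i _)).
have ge0 (c : I -> R) r : 0 <= w * \sum_i c i `^ r.
  by rewrite mulr_ge0 ?(ltW w0)// sumr_ge0// => i _; exact: powR_ge0.
(* A vanishing sum cannot be normalised, but then all its terms vanish and the left-hand side is
   0. *)
have [A0|A0] := eqVneq (w * \sum_i a i `^ p) 0.
  rewrite big1 ?mulr0 ?mulr_ge0 ?powR_ge0// => i _.
  by rewrite (nz _ _ p0 a0 A0) mul0r.
have [B0|B0] := eqVneq (w * \sum_i b i `^ q) 0.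
  rewrite big1 ?mulr0 ?mulr_ge0 ?powR_ge0// => i _.
  by rewrite (nz _ _ q0 b0 B0) mulr0.
set A := w * _ in A0 *; set B := w * _ in B0 *.
have {}A0 : 0 < A by rewrite lt_def A0 ge0.
have {}B0 : 0 < B by rewrite lt_def B0 ge0.
have rootK (C r : R) : 0 < C -> 0 < r -> ((C `^ r^-1)^-1) `^ r = C^-1.
  move=> C0 r0; rewrite -powRN -powRrM mulNr mulVf ?gt_eqF// powR_inv1//.
  exact: ltW.
have A'0 : 0 < A `^ p^-1 by exact: powR_gt0.
have B'0 : 0 < B `^ q^-1 by exact: powR_gt0.
(* Young's inequality will be applied to [a i] and [b i] divided by the roots of [A] and [B]; its
   bounds add up to 1/p + 1/q = 1. *)
have sum1 : w * \sum_i (a i `^ p / A / p + b i `^ q / B / q) = 1.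
  rewrite big_split/= -!mulr_suml mulrDr !mulrA -/A -/B.
  by rewrite !divff ?gt_eqF// !mul1r.
move: A B A0 B0 A'0 B'0 sum1 => A B A0 B0 A'0 B'0 sum1.
have : w * \sum_i a i * b i / (A `^ p^-1 * B `^ q^-1) <=
    w * \sum_i (a i `^ p / A / p + b i `^ q / B / q); last first.
  by rewrite [leRHS]sum1 -mulr_suml mulrA ler_pdivrMr ?mulr_gt0// mul1r.
rewrite ler_pM2l// ler_sum// => i _.
rewrite invfM mulrACA.
have iA : 0 <= (A `^ p^-1)^-1 by rewrite invr_ge0 ltW.
have iB : 0 <= (B `^ q^-1)^-1 by rewrite invr_ge0 ltW.
apply: (le_trans (conjugate_powR _ _ p0 q0 pq)); rewrite ?mulr_ge0//.
by rewrite !powRM// !rootK.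
Qed.

(** * The uniform cube as a probability space *)

Section UniformCube.
Context {R : realType} (n : nat).

(** A copy of [cube n] to carry the discrete sigma-algebra: [UMDplus_bound] quantifies over
    measurable types and is to be instantiated on the cube. *)
Definition cube_space : Type := cube n.
HB.instance Definition _ := Choice.copy cube_space (cube n).
HB.instance Definition _ := isPointed.Build cube_space ([ffun=> false] : cube n).
HB.instance Definition _ := @isMeasurable.Build default_measure_display
  cube_space discrete_measurable discrete_measurable0
  discrete_measurableC discrete_measurableU.

(** [msum] is indexed by [nat], hence the enumeration; only indices below [#|cube n|] occur, so the
    default of [nth] is not reached. *)
Definition cube_nth (k : nat) : cube n :=
  nth ([ffun=> false] : cube n) (enum (cube n)) k.

Definition cube_sum_dirac : set cube_space -> \bar R :=
  msum (fun k => \d_(cube_nth k : cube_space)) #|cube n|.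
HB.instance Definition _ := Measure.on cube_sum_dirac.

Definition cube_prob : set cube_space -> \bar R :=
  mscale (2 ^+ n)^-1%:nng cube_sum_dirac.
HB.instance Definition _ := Measure.on cube_prob.

Lemma sum_enum_cube (V : zmodType) (g : cube n -> V) :
  \sum_(k < #|cube n|) g (cube_nth k) =
  \sum_e g e.
Proof.
rewrite -(big_mkord xpredT (fun k => g (cube_nth k))).
by rewrite cardE -(big_nth _ xpredT g) big_enum.
Qed.

Lemma cube_probE (A : set cube_space) :
  cube_prob A = ((2 ^+ n)^-1 * \sum_(e : cube n) (e \in A)%:R)%:E.
Proof.
rewrite /cube_prob /mscale/= /cube_sum_dirac /msum/= EFinM; congr (_ * _)%E.
by rewrite -sum_enum_cube -sumEFin; apply: eq_bigr => k _; rewrite diracE.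
Qed.

Lemma cube_prob_setT : cube_prob setT = 1%E.
Proof.
rewrite cube_probE (eq_bigr (fun=> 1)); last by move=> e _; rewrite in_setT.
rewrite sumr_const card_ffun card_bool card_ord natrX mulVf//.
Qed.
HB.instance Definition _ := Measure_isProbability.Build _ _ _ cube_prob cube_prob_setT.

Lemma integral_cube (g : cube_space -> R) : (forall e, 0 <= g e) ->
  (\int[cube_prob]_t (g t)%:E = ((2 ^+ n)^-1 * \sum_(e : cube n) g e)%:E)%E.
Proof.
move=> g0; have g0E e : (0 <= (g e)%:E)%E by rewrite lee_fin.
rewrite ge0_integral_mscale//=.
rewrite EFinM; congr (_ * _)%E.
rewrite ge0_integral_measure_sum//=.
rewrite -sum_enum_cube -sumEFin; apply: eq_bigr => k _.
by rewrite integral_dirac//= diracT mul1e.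
Qed.

End UniformCube.

(** * Bochner integrals on the cube are finite sums *)

Section CubeBochner.
Context {R : realType} (n : nat) {Z : normedModType R}.
Implicit Types (A : set (cube_space n)) (s : cube_space n -> Z).

Lemma finite_cube (B : set (cube_space n)) : finite_set B.
Proof. exact: (@finite_finset (cube n) B). Qed.

Lemma simple_integral_cube A s :
  simple_integral (@cube_prob R n) A s =
  (2 ^+ n)^-1 *: \sum_(e : cube n | e \in A) s e.
Proof.
rewrite /simple_integral fsbig_finite/=; last exact/finite_image/finite_cube.
under eq_bigr => z _ do rewrite cube_probE/= -scalerA scaler_suml.
rewrite -scaler_sumr exchange_big/=; congr (_ *: _).
rewrite [RHS]big_mkcond/=; apply: eq_bigr => e _.
have se : s e \in finmap.enum_fset (fset_set (range s)).
  have := in_fset_set (finite_image s (finite_cube setT)) (s e).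
  by move=> ->; apply/mem_set; exists e.
rewrite (bigD1_seq (s e) se (finmap.fset_uniq _))/= big1 ?addr0.
  rewrite in_setI (_ : e \in s @^-1` [set s e]) ?andbT; last exact/mem_set.
  by case: ifP; rewrite ?scale1r ?scale0r.
move=> z zs; rewrite in_setI (_ : e \in s @^-1` [set z] = false) ?andbF ?scale0r//.
by apply/negP => /set_mem/= /eqP; rewrite eq_sym (negbTE zs).
Qed.

Lemma simple_fun_cube (G : set (set (cube_space n))) s :
  (forall z, G (s @^-1` [set z])) -> simple_fun G s.
Proof. by move=> Gs; split=> //; exact/finite_image/finite_cube. Qed.

Lemma strongly_measurable_cube (G : set (set (cube_space n))) s :
  (forall z, G (s @^-1` [set z])) -> strongly_measurable G s.
Proof.
move=> Gs; exists (fun=> s); split=> [k|t]; first exact: simple_fun_cube.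
exact: cvg_cst.
Qed.

(** On a finite discrete space [s] is itself simple, so a constant approximating sequence
    suffices. *)
Lemma has_bochner_integral_cube A s :
  has_bochner_integral (@cube_prob R n) A s
    ((2 ^+ n)^-1 *: \sum_(e : cube n | e \in A) s e).
Proof.
split; first exact: strongly_measurable_cube.
exists (fun=> s); split=> [k||]; first exact: simple_fun_cube.
  under eq_fun => k do under eq_integral => t _ do rewrite subrr normr0.
  rewrite integral0; exact: cvg_cst.
by rewrite -simple_integral_cube; exact: cvg_cst.
Qed.

End CubeBochner.

(** * Walsh martingales along an order of the coordinates *)

Section WalshMartingale.
Context {R : realType} (n : nat).
Implicit Types S A : {set 'I_n}.

(** The sigma-algebra generated by the coordinates in [S], described by invariance under the other
    flips so that Walsh cancellations are immediate. *)
Definition flip_invariant S : set (set (cube_space n)) :=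
  [set B | forall i (e : cube n), i \notin S -> B e -> B (flip i e)].

Lemma flip_invariant_sigma S : sigma_algebra setT (flip_invariant S).
Proof.
split=> [|B BS|B BS] i e iS //=.
  by move=> [_ nBe]; split=> // Bf; apply: nBe; rewrite -(flipK i e); exact: BS.
by move=> [k _ Be]; exists k => //; exact: BS.
Qed.

(** The conditional expectation of [g] given the coordinates in [S], in Walsh form. *)
Definition walsh_proj {V : lmodType R} S (g : cube n -> V) : cube n -> V :=
  fun e => \sum_(A : {set 'I_n} | A \subset S) walsh A e *: walsh_coef g A.

Lemma walsh_proj_flip {V : lmodType R} S (g : cube n -> V) i e : i \notin S ->
  walsh_proj S g (flip i e) = walsh_proj S g e.
Proof.
move=> iS; apply: eq_bigr => A AS; rewrite walsh_flip ifN//.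
by apply: contra iS; exact: (fintype.subsetP AS).
Qed.

(** For [i] in [A] but not in [S], flipping [i] preserves [B] and changes the sign of [walsh A]. *)
Lemma sum_walsh_flip_invariant S A (B : set (cube_space n)) :
  flip_invariant S B -> ~~ (A \subset S) ->
  \sum_(e : cube n | e \in B) walsh A e = 0 :> R.
Proof.
move=> BS /fintype.subsetPn[i iA iS].
have /eqP : \sum_(e : cube n | e \in B) walsh A e =
    - \sum_(e : cube n | e \in B) walsh A e :> R.
  rewrite [LHS](reindex_inj (can_inj (flipK i)))/= -sumrN.
  apply: eq_big => [e|e _]; last by rewrite walsh_flip iA.
  apply/idP/idP => /set_mem H; apply/mem_set; last exact: BS.
  by rewrite -(flipK i e); exact: BS.
by rewrite -addr_eq0 -mulr2n mulrn_eq0/= => /eqP.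
Qed.

Context {Z : normedModType R}.

Lemma walsh_proj_measurable S (g : cube n -> Z) :
  strongly_measurable (flip_invariant S) (walsh_proj S g : cube_space n -> Z).
Proof.
by apply: strongly_measurable_cube => z i e iS /= <-; exact: walsh_proj_flip.
Qed.

(** Walsh terms with [A] not inside [S] integrate to 0 over every [B] of the smaller sigma-algebra;
    the remaining terms are common to both projections. *)
Lemma walsh_proj_cond_expectation S S' (g : cube n -> Z) : S \subset S' ->
  is_cond_expectation (@cube_prob R n) (flip_invariant S)
    (walsh_proj S' g : cube_space n -> Z) (walsh_proj S g).
Proof.
move=> SS'; split=> [|B BS]; first exact: walsh_proj_measurable.
exists ((2 ^+ n)^-1 *: \sum_(e : cube n | e \in B) walsh_proj S' g e).
split; first exact: has_bochner_integral_cube.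
suff -> : \sum_(e : cube n | e \in B) walsh_proj S' g e =
          \sum_(e : cube n | e \in B) walsh_proj S g e.
  exact: has_bochner_integral_cube.
rewrite /walsh_proj exchange_big/= [RHS]exchange_big/=.
rewrite [LHS](bigID (fun A : {set 'I_n} => A \subset S))/= [X in _ + X]big1 ?addr0.
  apply: eq_bigl => A; rewrite andbC; case: (boolP (A \subset S)) => //= AS.
  exact: fintype.subset_trans AS SS'.
move=> A /andP[_ AS]; rewrite -scaler_suml.
by rewrite (sum_walsh_flip_invariant BS AS) scale0r.
Qed.

Variables (s : 'S_n) (g : cube n -> Z).

(** [s i] is the step, counted from 0, at which coordinate [i] is revealed. *)
Definition initial_set (j : nat) : {set 'I_n} := [set i | (s i < j)%N]%SET.

Definition walsh_martingale (j : nat) : cube_space n -> Z :=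
  walsh_proj (initial_set j) g.

Lemma walsh_martingale_n : walsh_martingale n = g.
Proof.
apply/funext => e; rewrite [RHS]walsh_expansion /walsh_martingale /walsh_proj.
apply: eq_bigl => A; apply/fintype.subsetP => i _; rewrite inE; exact: ltn_ord.
Qed.

Lemma initial_setS i j : (i <= j)%N -> initial_set i \subset initial_set j.
Proof.
by move=> ij; apply/fintype.subsetP => k; rewrite !inE => /leq_trans; apply.
Qed.

Lemma walsh_martingaleP (r : R) :
  Lr_martingale (@cube_prob R n) r n
    (fun j => flip_invariant (initial_set j)) walsh_martingale.
Proof.
split.
- split=> [j _|i j /andP[ij _] B Bi k e kj].
    by split=> //; exact: flip_invariant_sigma.
  by apply: Bi; apply: contra kj; exact: (fintype.subsetP (initial_setS ij)).
- by move=> j _; exact: walsh_proj_measurable.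
- by move=> j _; rewrite integral_cube ?ltry// => e; exact: powR_ge0.
- move=> i j /andP[ij _]; apply: walsh_proj_cond_expectation.
  exact: initial_setS.
Qed.

End WalshMartingale.

(** * The last element of a set under a random order *)

Section LastInOrder.
Context (n : nat).
Implicit Types (A : {set 'I_n}) (s : 'S_n) (i : 'I_n).

(** Written as the condition under which [walsh A] enters the martingale exactly when [i] is
    revealed; [is_lastE] gives the order-theoretic form. *)
Definition is_last s i A : bool :=
  (A \subset initial_set s (s i).+1) && ~~ (A \subset initial_set s (s i)).

Lemma is_lastE s i A :
  is_last s i A = (i \in A) && [forall k in A, (s k <= s i)%N].
Proof.
rewrite /is_last andbC.
have -> : A \subset initial_set s (s i).+1 = [forall k in A, (s k <= s i)%N].
  apply/fintype.subsetP/forall_inP => H k kA; first by have := H k kA; rewrite inE.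
  by rewrite inE; exact: H.
case: (boolP [forall k in A, _]) => [/forall_inP H|]; last by rewrite !andbF.
rewrite !andbT; apply/idP/idP.
  move=> /fintype.subsetPn[k kA]; rewrite inE -leqNgt => ik.
  suff /perm_inj <- : s k = s i by [].
  by apply/val_inj/eqP; rewrite eqn_leq ik H.
by move=> iA; apply/fintype.subsetPn; exists i; rewrite // inE ltnn.
Qed.

Lemma sum_is_last s A : A != finset.set0 -> (\sum_(i in A) is_last s i A = 1)%N.
Proof.
move=> /finset.set0Pn[i0 i0A].
have [i iA imax] := arg_maxnP (fun k : 'I_n => s k : nat) i0A.
rewrite (bigD1 i)//= big1 ?addn0 => [|k /andP[kA ki]].
  rewrite is_lastE [i \in A]iA; apply/eqP; rewrite eqb1.
  by apply/forall_inP => k kA; exact: imax.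
apply/eqP; rewrite eqb0 is_lastE kA; apply: contra ki => /forall_inP H.
by apply/eqP/(@perm_inj _ s)/val_inj/eqP; rewrite eqn_leq H// andbT; exact: imax.
Qed.

Lemma is_last_tperm s i k A : i \in A -> k \in A ->
  is_last (tperm i k * s)%g k A = is_last s i A.
Proof.
move=> iA kA; rewrite !is_lastE iA kA permM tpermR /=.
have tA x : x \in A -> tperm i k x \in A.
  by move=> xA; case: tpermP => [_|_|].
apply/forall_inP/forall_inP => H x xA; last by rewrite permM H// tA.
by have := H _ (tA x xA); rewrite permM tpermK.
Qed.

(** Composing with [tperm i k] shows that all elements of [A] are last equally often, and exactly
    one is last for each [s]. The product form keeps the count in [nat]. *)
Lemma count_is_last i A : i \in A ->
  (#|A| * \sum_(s : 'S_n) is_last s i A = n`!)%N.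
Proof.
move=> iA; have A0 : A != finset.set0 by apply/finset.set0Pn; exists i.
have -> : n`! = (\sum_(s : 'S_n) \sum_(k in A) is_last s k A)%N.
  rewrite (eq_bigr (fun=> 1%N)) => [|s _]; last exact: sum_is_last.
  by rewrite sum1_card; exact/esym/card_Sn.
rewrite exchange_big/= -sum_nat_const; apply: eq_bigr => k kA.
rewrite [RHS](reindex_inj (mulgI (tperm i k)))/=.
by apply: eq_bigr => s _; rewrite is_last_tperm.
Qed.

End LastInOrder.

(** * Walsh form and kernel of Delta^{-1} d_j *)

Section InverseLaplacianPartial.
Context {R : realType} (n : nat) {V : lmodType R}.
Implicit Types (g : cube n -> V) (A : {set 'I_n}).

(** By invariance of the mean the flip moves from [g] onto [walsh A], where it is only a sign. *)
Lemma walsh_coef_partial j g A :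
  walsh_coef (partial j g) A = if j \in A then walsh_coef g A else 0.
Proof.
transitivity (2^-1 *: (walsh_coef g A -
    cube_mean (fun e => walsh A (flip j e) *: g e))).
  rewrite [X in _ - X](cube_mean_flip j) /walsh_coef /cube_mean -scalerBr -sumrB.
  rewrite scalerA [2^-1 * _]mulrC -scalerA; congr (_ *: _); rewrite scaler_sumr.
  by apply: eq_bigr => e _; rewrite flipK /partial -scalerBr !scalerA mulrC.
rewrite /walsh_coef; under [X in _ - cube_mean X]eq_fun => e do rewrite walsh_flip.
case: ifPn => _; last by rewrite subrr scaler0.
have -> : cube_mean (fun e => - walsh A e *: g e) =
    - cube_mean (fun e => walsh A e *: g e).
  rewrite /cube_mean -scalerN -sumrN; congr (_ *: _).
  by apply: eq_bigr => e _; rewrite scaleNr.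
rewrite opprK -mulr2n -(scaler_nat _ (cube_mean _)) scalerA.
by rewrite mulVf ?scale1r// pnatr_eq0.
Qed.

Lemma inv_laplacian_partialE j g e : inv_laplacian (partial j g) e =
  \sum_(A : {set 'I_n} | j \in A) #|A|%:R^-1 *: (walsh A e *: walsh_coef g A).
Proof.
rewrite inv_laplacian_walshE [LHS]big_mkcond [RHS]big_mkcond/=.
apply: eq_bigr => A _; rewrite walsh_coef_partial; case: ifPn => [A0|].
  by case: ifP => //; rewrite !scaler0.
by rewrite negbK => /eqP ->; rewrite inE.
Qed.

(** One real kernel serves functions with values in [X] and in [dual X]; its symmetry makes
    Delta^{-1} d_j self-adjoint for their pairing. *)
Definition inv_laplacian_partial_kernel (j : 'I_n) (e e' : cube n) : R :=
  (2 ^+ n)^-1 * \sum_(A : {set 'I_n} | j \in A) #|A|%:R^-1 * (walsh A e * walsh A e').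

Lemma inv_laplacian_partial_kernelP j g e : inv_laplacian (partial j g) e =
  \sum_e' inv_laplacian_partial_kernel j e e' *: g e'.
Proof.
rewrite inv_laplacian_partialE.
under [RHS]eq_bigr => e' _ do
  rewrite /inv_laplacian_partial_kernel mulr_sumr scaler_suml.
rewrite [RHS]exchange_big/=; apply: eq_bigr => A _.
rewrite /walsh_coef /cube_mean scalerA scalerA scaler_sumr.
apply: eq_bigr => e' _; rewrite scalerA; congr (_ *: _).
ring.
Qed.

Lemma inv_laplacian_partial_kernel_sym j e e' :
  inv_laplacian_partial_kernel j e e' = inv_laplacian_partial_kernel j e' e.
Proof. by congr (_ * _); apply: eq_bigr => A _; rewrite (mulrC (walsh A e)). Qed.

End InverseLaplacianPartial.

(** * Averaging martingale increments over all orders *)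

Section OrderAveraging.
Context {R : realType} (n : nat) {Z : normedModType R}.
Implicit Types (g : cube n -> Z) (s : 'S_n).

Definition walsh_increment s g (i : 'I_n) (e : cube n) : Z :=
  walsh_martingale s g (s i).+1 e - walsh_martingale s g (s i) e.

Lemma walsh_incrementE s g i e : walsh_increment s g i e =
  \sum_(A : {set 'I_n} | is_last s i A) walsh A e *: walsh_coef g A.
Proof.
rewrite /walsh_increment /walsh_martingale /walsh_proj.
apply/eqP; rewrite subr_eq addrC; apply/eqP.
rewrite (bigID (fun A : {set 'I_n} => A \subset initial_set s (s i)))/=.
congr (_ + _).
apply: eq_bigl => A; apply: andb_idl => /fintype.subset_trans; apply.
exact: initial_setS.
Qed.

(** For [i] in [A], the coefficient of [walsh A] counts the orders in which [i] is last in [A]; by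
    [count_is_last] this is n!/|A|, the source of the factor 1/|A| of Delta^{-1}. *)
Lemma sum_walsh_increment g i e :
  \sum_(s : 'S_n) walsh_increment s g i e =
  (n`!)%:R *: inv_laplacian (partial i g) e.
Proof.
under eq_bigr => s _ do rewrite walsh_incrementE big_mkcond.
rewrite exchange_big/= inv_laplacian_partialE scaler_sumr [RHS]big_mkcond/=.
apply: eq_bigr => A _; case: ifPn => iA; last first.
  by rewrite big1// => s _; rewrite is_lastE (negbTE iA).
rewrite [RHS]scalerA -(count_is_last iA) natrM mulrAC divff ?mul1r; last first.
  by rewrite pnatr_eq0 cards_eq0; apply/finset.set0Pn; exists i.
rewrite natr_sum scaler_suml; apply: eq_bigr => s _.
by case: is_last; rewrite ?scale1r ?scale0r.
Qed.

End OrderAveraging.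

(** * Pairing with functionals and the adjoint identity *)

Section DualPairing.
Context {R : realType} {X : normedModType R}.
Implicit Types (f : dual X) (x : X).

Lemma dual_fun_sum f (I : Type) (r : seq I) (P : pred I) (x : I -> X) :
  f (\sum_(i <- r | P i) x i) = \sum_(i <- r | P i) f (x i).
Proof. by have [h <-] := dual_linfun f; rewrite linear_sum. Qed.

Lemma dual_sumx (I : Type) (r : seq I) (P : pred I) (f : I -> dual X) x :
  (\sum_(i <- r | P i) f i) x = \sum_(i <- r | P i) (f i x : R).
Proof. exact: (big_morph (fun h : dual X => h x : R)). Qed.

Lemma inv_laplacian_partial_adjoint n j (G : cube n -> dual X) (f : cube n -> X) :
  \sum_e (G e (inv_laplacian (partial j f) e) : R) =
  \sum_e inv_laplacian (partial j G) e (f e).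
Proof.
under eq_bigr => e _ do rewrite inv_laplacian_partial_kernelP dual_fun_sum.
rewrite exchange_big/=; apply: eq_bigr => e _.
rewrite inv_laplacian_partial_kernelP dual_sumx; apply: eq_bigr => e' _.
by rewrite dual_funZ dualZx inv_laplacian_partial_kernel_sym.
Qed.

End DualPairing.

(** * The UMD^+ estimate for signed increments *)

Definition signed_increments {R : realType} (n : nat) {Z : normedModType R}
    (s : 'S_n) (g : cube n -> Z) (e d : cube n) : Z :=
  \sum_(i < n) sgn d i *: walsh_increment s g i e.

Lemma sum_signed_increments (R : realType) (n : nat) (Z : normedModType R)
    (g : cube n -> Z) (e d : cube n) :
  \sum_(s : 'S_n) signed_increments s g e d =
  (n`!)%:R *: \sum_(j < n) sgn d j *: inv_laplacian (partial j g) e.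
Proof.
rewrite exchange_big/= scaler_sumr; apply: eq_bigr => j _.
by rewrite -scaler_sumr sum_walsh_increment !scalerA mulrC.
Qed.

Lemma sum_signed_increments_pairing (R : realType) (n : nat)
    (X : normedModType R) (G : cube n -> dual X) (e d : cube n) (x : X) :
  \sum_(s : 'S_n) (signed_increments s G e d x : R) =
  (n`!)%:R * \sum_(j < n) sgn d j * (inv_laplacian (partial j G) e x : R).
Proof.
rewrite -dual_sumx sum_signed_increments.
rewrite (dualZx _ (\sum_(j < n) sgn d j *: inv_laplacian (partial j G) e)).
by rewrite dual_sumx.
Qed.

Lemma sum_UMD_increments (R : realType) (Z : completeNormedModType R) (n : nat)
    (s : 'S_n) (g : cube n -> Z) (q beta : R) : UMDplus_bound Z q beta ->
  (2 ^+ n)^-1 ^+ 2 * \sum_(x : cube n * cube n)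
    `|walsh_martingale s g 0 x.1 + signed_increments s g x.1 x.2| `^ q
  <= beta `^ q * ((2 ^+ n)^-1 * \sum_e `|g e| `^ q).
Proof.
move=> /(_ n _ _ _ _ _ (walsh_martingaleP s g q)).
under eq_bigr => d _ do
  (rewrite integral_cube; last by move=> t; exact: powR_ge0).
rewrite integral_cube => [|e]; last exact: powR_ge0.
rewrite walsh_martingale_n sumEFin -!EFinM lee_fin; apply: le_trans.
rewrite expr2 -mulrA ler_pM2l ?invr_gt0 ?exprn_gt0// -mulr_sumr.
rewrite ler_pM2l ?invr_gt0 ?exprn_gt0//.
rewrite -(pair_bigA _ (fun e d : cube n =>
  `|walsh_martingale s g 0 e + signed_increments s g e d| `^ q))/= exchange_big/=.
(* The UMD^+ inequality attaches signs to times, [signed_increments] to coordinates. Permuting the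
   signs by [s] is a bijection of the cube that matches the two. *)
pose h (d : cube n) : cube n := [ffun j => d (s j)].
have hK : cancel h (fun d => [ffun j => d ((s^-1)%g j)]).
  by move=> d; apply/ffunP => j; rewrite !ffunE permKV.
rewrite [leLHS](reindex_inj (can_inj hK))/=; apply: ler_sum => d _.
apply: ler_sum => e _; rewrite le_eqVlt; apply/orP; left; apply/eqP.
congr (`|_ + _| `^ _); rewrite /signed_increments [RHS](reindex_inj (@perm_inj _ s)).
by apply: eq_bigr => i _; rewrite /sgn ffunE.
Qed.

Lemma pairing_le (R : realType) (X : normedModType R) (I : finType) (w p q : R)
    (T : I -> dual X) (F : I -> X) :
  0 < w -> 0 < p -> 0 < q -> p^-1 + q^-1 = 1 ->
  w * \sum_i (T i (F i) : R) <=
    (w * \sum_i `|T i| `^ q) `^ q^-1 * (w * \sum_i `|F i| `^ p) `^ p^-1.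
Proof.
move=> w0 p0 q0 pq; rewrite addrC in pq.
apply: le_trans (weighted_hoelder w0 q0 p0 pq _ _) => //.
rewrite ler_pM2l// ler_sum// => i _.
exact: le_trans (ler_norm _) (dual_normP _ _).
Qed.

Lemma dual_double_split (R : realType) (X : normedModType R) (f g : dual X) (x : X) :
  2 * (f x : R) = (g + f) x + (f - g) x.
Proof.
rewrite !dualDx dualNx; move: (f x) (g x) => a b.
by rewrite -[_ + _]/(b + a + (a - b) : R); ring.
Qed.

(** * Duality bounds for a fixed admissible [beta] *)

Section Duality.
Context {R : realType} {X : completeNormedModType R} {n : nat}.
Context {p q beta : R} (p0 : 0 < p) (q0 : 0 < q) (pq : p^-1 + q^-1 = 1).
Context (beta0 : 0 <= beta) (betaP : UMDplus_bound (dual X) q beta).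
Implicit Types (G : cube n -> dual X) (F : cube n -> cube n -> X).

(** Hölder's inequality combined with UMD^+. The latter controls the increments together with the
    initial value of the martingale; removing that value by symmetry instead of the triangle
    inequality keeps the constant [beta]. *)
Lemma signed_increments_pairing_le (s : 'S_n) G F :
  (2 ^+ n)^-1 ^+ 2 *
    \sum_(x : cube n * cube n) (signed_increments s G x.1 x.2 (F x.1 x.2) : R) <=
  beta * ((2 ^+ n)^-1 * \sum_e `|G e| `^ q) `^ q^-1 *
    ((2 ^+ n)^-1 ^+ 2 * \sum_(x : cube n * cube n) `|F x.1 x.2| `^ p) `^ p^-1.
Proof.
set w := _ ^+ 2; set B := (w * _) `^ p^-1.
have w0 : 0 < w by rewrite exprn_gt0// invr_gt0 exprn_gt0.
pose M0 e := walsh_martingale s G 0 e.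
pose neg (d : cube n) : cube n := [ffun i => ~~ d i].
have negK : involutive neg by move=> d; apply/ffunP => i; rewrite !ffunE negbK.
have Sneg e d : signed_increments s G e (neg d) = - signed_increments s G e d.
  rewrite /signed_increments -sumrN; apply: eq_bigr => i _.
  by rewrite /sgn ffunE signrN scaleNr.
have bound (T : cube n * cube n -> dual X) :
    w * \sum_x `|T x| `^ q <= beta `^ q * ((2 ^+ n)^-1 * \sum_e `|G e| `^ q) ->
    w * \sum_x (T x (F x.1 x.2) : R) <=
      beta * ((2 ^+ n)^-1 * \sum_e `|G e| `^ q) `^ q^-1 * B.
  move=> TG; apply: (le_trans (pairing_le _ _ w0 p0 q0 pq)).
  have sum_ge0 (I : finType) (a : I -> R) : 0 <= \sum_i a i `^ q.
    by apply: sumr_ge0 => i _; exact: powR_ge0.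
  rewrite ler_wpM2r ?powR_ge0//.
  have -> : beta * ((2 ^+ n)^-1 * \sum_e `|G e| `^ q) `^ q^-1 =
      (beta `^ q * ((2 ^+ n)^-1 * \sum_e `|G e| `^ q)) `^ q^-1.
    rewrite [RHS]powRM ?powR_ge0 ?mulr_ge0 ?invr_ge0 ?exprn_ge0//.
    by rewrite -powRrM divff ?gt_eqF// powRr1.
  by rewrite ge0_ler_powR ?invr_ge0 ?(ltW q0) ?nnegrE ?mulr_ge0 ?powR_ge0 ?invr_ge0
    ?exprn_ge0 ?(ltW w0).
have bound1 := bound (fun x => M0 x.1 + signed_increments s G x.1 x.2)
  (sum_UMD_increments s G betaP).
(* del |-> - del flips the signed increments; averaging both bounds removes the
   constant term M0. *)
have bound2 : w * \sum_(x : cube n * cube n)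
      ((signed_increments s G x.1 x.2 - M0 x.1) (F x.1 x.2) : R) <=
    beta * ((2 ^+ n)^-1 * \sum_e `|G e| `^ q) `^ q^-1 * B.
  apply: (bound (fun x => signed_increments s G x.1 x.2 - M0 x.1)).
  apply: le_trans (sum_UMD_increments s G betaP).
  have negJ : injective (fun x : cube n * cube n => (x.1, neg x.2)).
    by move=> [e d] [e' d'] [-> /(can_inj negK) ->].
  rewrite [in leRHS](reindex_inj negJ)/=.
  rewrite le_eqVlt; apply/orP; left; apply/eqP; congr (_ * _).
  by apply: eq_bigr => x _; rewrite Sneg -normrN opprB.
rewrite -(ler_pM2l (ltr0n R 2)) [in leRHS]mulr_natl mulr2n.
apply: le_trans (lerD bound1 bound2).
rewrite -mulrDr -big_split/= mulrCA ler_pM2l// mulr_sumr ler_sum// => x _ /=.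
by rewrite (dual_double_split _ (M0 x.1)).
Qed.

(** Self-adjointness moves Delta^{-1} d_j onto [G], and expanding F_j as a mean over del turns the
    pairing into the average over [s] of those bounded in [signed_increments_pairing_le]. *)
Lemma inv_laplacian_pairing_le G F :
  (2 ^+ n)^-1 * \sum_e (G e (\sum_(j < n)
    inv_laplacian (partial j (rademacher_coef F j)) e) : R) <=
  beta * ((2 ^+ n)^-1 * \sum_e `|G e| `^ q) `^ q^-1 *
    ((2 ^+ n)^-1 ^+ 2 * \sum_(x : cube n * cube n) `|F x.1 x.2| `^ p) `^ p^-1.
Proof.
set B := leRHS.
have -> : \sum_e (G e (\sum_(j < n)
      inv_laplacian (partial j (rademacher_coef F j)) e) : R) =
    \sum_e \sum_(j < n) (inv_laplacian (partial j G) e (rademacher_coef F j e) : R).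
  under eq_bigr => e _ do rewrite dual_fun_sum.
  rewrite exchange_big/= [RHS]exchange_big/=; apply: eq_bigr => j _.
  exact: inv_laplacian_partial_adjoint.
have nf0 : 0 < (n`!)%:R :> R by rewrite ltr0n fact_gt0.
rewrite -(ler_pM2l nf0).
have -> : (n`!)%:R * B = \sum_(s : 'S_n) B.
  by rewrite sumr_const card_Sn mulr_natl.
apply: le_trans (ler_sum _ (fun s _ => signed_increments_pairing_le s G F)).
rewrite le_eqVlt; apply/orP; left; apply/eqP.
(* Of the two factors 2^-n, one averages over eps; the other is the mean over del inside
   [rademacher_coef], matched at the end. *)
rewrite -mulr_sumr mulrCA expr2 -[RHS]mulrA; congr (_ * _).
under [X in _ = _ * X]eq_bigr => s _ do rewrite -(pair_bigA _ (fun e d : cube n =>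
  (signed_increments s G e d (F e d) : R)))/=.
rewrite [in RHS]exchange_big/= !mulr_sumr; apply: eq_bigr => e _.
rewrite [in RHS]exchange_big/=.
under [X in _ = _ * X]eq_bigr => d _ do rewrite sum_signed_increments_pairing.
rewrite -mulr_sumr mulrCA; congr (_ * _).
rewrite exchange_big/= mulr_sumr; apply: eq_bigr => j _.
rewrite /rademacher_coef /cube_mean dual_funZ dual_fun_sum; congr (_ * _).
by apply: eq_bigr => d _; rewrite dual_funZ.
Qed.

End Duality.

(** * From pairings to norms, and from [beta] to the best constant *)

Lemma norm_le_of_pairing (R : realType) (X : completeNormedModType R) (n : nat)
    (p q C : R) (h : cube n -> X) : 1 < p -> p^-1 + q^-1 = 1 -> 0 <= C ->
  (forall G : cube n -> dual X, (2 ^+ n)^-1 * \sum_e (G e (h e) : R) <=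
     C * ((2 ^+ n)^-1 * \sum_e `|G e| `^ q) `^ q^-1) ->
  ((2 ^+ n)^-1 * \sum_e `|h e| `^ p) `^ p^-1 <= C.
Proof.
move=> p1 pq C0 hC; have p0 : 0 < p by exact: lt_trans p1.
have qE : q^-1 = (p - 1) / p by rewrite mulrBl mul1r divff ?gt_eqF// -pq addrAC subrr add0r.
have q0 : 0 < q by rewrite -invr_gt0 qE divr_gt0// subr_gt0.
have c0 : 0 < (2 ^+ n)^-1 :> R by rewrite invr_gt0 exprn_gt0.
pose phi e := projT1 (cid (norming_functional (h e))).
have phiP e : `|phi e| <= 1 /\ phi e (h e) = `|h e|.
  exact: (projT2 (cid (norming_functional (h e)))).
(* The extremal choice in Hölder's inequality: the pairing becomes the mean of ‖h‖^p, and ‖G‖^q is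
   at most ‖h‖^p because (p - 1) q = p. *)
have := hC (fun e => `|h e| `^ (p - 1) *: phi e).
have -> : \sum_e ((`|h e| `^ (p - 1) *: phi e) (h e) : R) = \sum_e `|h e| `^ p.
  apply: eq_bigr => e _; rewrite dualZx (phiP e).2 mulrC mulr_powRB1//.
set H := _ * \sum_e _ => HC.
have H0 : 0 <= H by rewrite mulr_ge0 ?(ltW c0)// sumr_ge0// => e _; exact: powR_ge0.
have {}HC : H <= C * H `^ q^-1.
  apply: (le_trans HC); rewrite ler_wpM2l//.
  rewrite ge0_ler_powR ?invr_ge0 ?(ltW q0)// ?nnegrE ?mulr_ge0 ?(ltW c0)//.
    by apply: sumr_ge0 => e _; exact: powR_ge0.
  rewrite ler_pM2l// ler_sum// => e _.
  have -> : `|h e| `^ p = (`|h e| `^ (p - 1)) `^ q.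
    by rewrite -powRrM -[q in RHS]invrK qE invf_div mulrCA divff ?mulr1// subr_eq0 gt_eqF.
  rewrite ge0_ler_powR ?(ltW q0)// ?nnegrE ?powR_ge0//.
  by rewrite normrZ ger0_norm ?powR_ge0// ler_piMr ?powR_ge0// (phiP e).1.
(* For nonzero [H], dividing [HC] by H^(1/q) leaves H^(1/p) on the left. *)
have [->|Hn0] := eqVneq H 0; first by rewrite powR0 ?invr_eq0 ?gt_eqF.
have Hq : 0 < H `^ q^-1 by apply: powR_gt0; rewrite lt_def Hn0.
rewrite -(ler_pM2r Hq) -powRD ?pq ?powRr1// oner_eq0//.
Qed.

(** Dividing by [b] makes [a / b] a lower bound of the admissible constants; UMD^+ makes their set
    nonempty, so [inf] is a genuine infimum. When [b = 0], any one admissible constant gives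
    [a <= 0]. *)
Lemma le_UMDplus_const_mul (R : realType) (Z : completeNormedModType R)
    (q a b : R) : 1 < q -> UMDplus Z -> 0 <= b ->
  (forall beta, 0 < beta -> UMDplus_bound Z q beta -> a <= beta * b) ->
  a <= UMDplus_const Z q * b.
Proof.
move=> q1 /(_ _ q1)[beta1 beta10 beta1P]; rewrite le_eqVlt => /predU1P[<-|b0] H.
  by rewrite mulr0 -(mulr0 beta1) H.
rewrite -ler_pdivrMr//; apply: lb_le_inf; first by exists beta1.
by move=> beta [beta0 betaP]; rewrite ler_pdivrMr// H.
Qed.

Theorem theorem1p4 (R : realType) (X : completeNormedModType R)
    (hX : UMDplus (dual X)) (p : R) (hp : 1 < p) (n : nat)
    (F : cube n -> cube n -> X) :
  let q := p / (p - 1) in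
  (cube_mean (fun e : cube n =>
     `|\sum_(j < n) inv_laplacian (partial j (rademacher_coef F j)) e| `^ p
     : R^o)) `^ p^-1
  <= UMDplus_const (dual X) q *
     (cube_mean (fun d : cube n =>
        cube_mean (fun e : cube n => `|F e d| `^ p : R^o))) `^ p^-1.
Proof.
lazy zeta; set q := p / (p - 1); have p0 : 0 < p by exact: lt_trans hp.
have p10 : 0 < p - 1 by rewrite subr_gt0.
have q1 : 1 < q by rewrite /q ltr_pdivlMr// mul1r; lra.
have pq : p^-1 + q^-1 = 1.
  by rewrite /q invf_div -[in X in X + _](mul1r p^-1) -mulrDl subrKC divff ?gt_eqF.
(* The iterated means become one sum over pairs, the form in which Hölder's inequality was
   applied. *)
have -> : cube_mean (fun d : cube n =>
      cube_mean (fun e : cube n => `|F e d| `^ p : R^o)) =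
    (2 ^+ n)^-1 ^+ 2 * \sum_(x : cube n * cube n) `|F x.1 x.2| `^ p.
  rewrite /cube_mean -scaler_sumr scalerA -expr2; congr (_ * _).
  rewrite exchange_big/=.
  exact: (pair_bigA _ (fun e d : cube n => `|F e d| `^ p)).
apply: le_UMDplus_const_mul => //; first exact: powR_ge0.
move=> beta beta0 betaP; apply: (norm_le_of_pairing hp pq).
  by rewrite mulr_ge0 ?powR_ge0// ltW.
move=> G; rewrite mulrAC.
exact: (inv_laplacian_pairing_le p0 (lt_trans ltr01 q1) pq (ltW beta0) betaP).
Qed.
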